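(* Let $n,d,c\ge 1$ and $t\ge 0$ be integers with $I_{c,(n,d,t)}\ne 0$. Write $d=kc+r$ with integers $k\ge 0$ and $0<r\le c$; in other words, $k=\lfloor (d-1)/c\rfloor$. Then the partially ordered set $(G(I_{c,(n,d,t)}),\prec)$ has a unique maximal element, namely $x_{a_1}\cdots x_{a_d}$ with $$a_i=n-k-t(d-1)+(i-1)t+\left\lceil\frac{i-r}{c}\right\rceil=a_1+(i-1)t+\left\lceil\frac{i-r}{c}\right\rceil\qquad (i=1,\dots,d),$$ in other words $a_{d-i+1}=n-(i-1)t-\left\lfloor\frac{i-1}{c}\right\rfloor$ for $i=1,\dots,d$, and it has a unique minimal element, namely $x_{\alpha_1}\cdots x_{\alpha_d}$ with $$\alpha_i=(i-1)t+\left\lfloor\frac{i-1}{c}\right\rfloor+1\qquad (i=1,\dots,d).$$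
   Context: $K$ is a field and $S=K[x_1,\dots,x_n]$. A multiset $A=\{i_1\le i_2\le\cdots\le i_d\}$ with elements in $[n]=\{1,\dots,n\}$ is $t$-spread if $i_{k+1}-i_k\ge t$ for all $k$. For a $t$-spread multiset $A$, a block of size $r$ of $A$ is a sub-multiset of consecutive elements $B=\{i_k\le i_{k+1}\le\cdots\le i_{k+r-1}\}$ with $i_{l+1}-i_l=t$ for all consecutive elements of $B$; $|B|=r$ denotes its size (counted with multiplicity). $\mathcal A_{c,(n,d,t)}$ is the set of all $t$-spread multisets $A$ in $[n]$ with $d$ elements (counted with multiplicity) such that $|B|\le c$ for every block $B\subset A$. For a multiset $A=\{i_1\le\cdots\le i_d\}$ put $\mathbf x_A=x_{i_1}\cdots x_{i_d}$. The $c$-bounded $t$-spread Veronese ideal is $I_{c,(n,d,t)}=(\mathbf x_A : A\in\mathcal A_{c,(n,d,t)})\subset S$. For a monomial ideal $I$, $G(I)$ denotes its set of minimal monomial generators. The partial order $\prec$ on $G(I_{c,(n,d,t)})$: for $u,v\in G(I_{c,(n,d,t)})$ say that $u$ covers $v$ if there exist $i<j$ such that $x_j$ divides $u$ and $v=x_iu/x_j$; the order $\prec$ (with $v\prec u$ when $u$ covers $v$) is the partial order generated by these relations. *)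

(* Defs.v *)
From Stdlib Require Import Relations Classical_Prop.
From HB Require Import structures.
From mathcomp Require Import all_boot all_order all_algebra.
From mathcomp Require Import mpoly.

Set Implicit Arguments.
Unset Strict Implicit.
Unset Printing Implicit Defensive.

Import GRing.Theory.
Local Open Scope ring_scope.

(* The paper's variables x_1, ..., x_n are 'X_i for i : 'I_n, so i : 'I_n      *)
(* stands for the element i.+1 of [n].  A multiset {i_1 <= ... <= i_d} in [n]  *)
(* is the sequence of its elements in nondecreasing order.  Being t-spread and *)
(* being a block only involve differences, so the shift does not matter there. *)

Section Multisets.
Context {n : nat}.
Implicit Types A B : seq 'I_n.

(* This entails that A is nondecreasing, also when t = 0. *)
Definition t_spread (t : nat) A : bool :=
  sorted (fun i j : 'I_n => (i + t <= j)%N) A.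

Definition block (t : nat) B A : bool :=
  infix B A && sorted (fun i j : 'I_n => (i + t == j)%N) B.

Definition bounded_spread (c d t : nat) A : Prop :=
  [/\ size A = d, t_spread t A & forall B, block t B A -> (size B <= c)%N].

(* The element i_k of A, as an element of {1, ..., n}, for 1 <= k <= size A. *)
Definition entry A (k : nat) : nat :=
  nth 0%N [seq (val i).+1 | i <- A] k.-1.

Definition xmon A : 'X_{1..n} := (\sum_(i <- A) U_(i))%MM.

Lemma mpolyX_xmon (K : fieldType) A :
  'X_[xmon A] = \prod_(i <- A) 'X_i :> {mpoly K[n]}.
Proof. by rewrite mprodXE. Qed.

End Multisets.

Definition ideal_gen (R : comNzRingType) (X : R -> Prop) (f : R) : Prop :=
  exists2 s : seq (R * R),
    forall p, p \in s -> X p.2 & f = \sum_(p <- s) p.1 * p.2.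

Section MonomialIdeals.
Context {K : fieldType} {n : nat}.
Implicit Types (I : {mpoly K[n]} -> Prop) (M : 'X_{1..n} -> Prop).
Implicit Types u v w : 'X_{1..n}.

Definition mon_ideal M : {mpoly K[n]} -> Prop :=
  ideal_gen (fun f => exists2 m, M m & f = 'X_[m]).

(* G(I): the monomials of I that are minimal for divisibility.  For a monomial *)
(* ideal I this is the smallest set of monomials generating I, see             *)
(* min_gens_gen and min_gens_least below.                                      *)
Definition min_gens I u : Prop :=
  I 'X_[u] /\ (forall v, I 'X_[v] -> (v <= u)%MM -> v = u).

(* u covers v *)
Definition covers I u v : Prop :=
  [/\ min_gens I u, min_gens I v &
      exists i j : 'I_n,
        [/\ (i < j)%N, (U_(j) <= u)%MM & v = (u - U_(j) + U_(i))%MM]].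

(* The reflexive version of the order generated by the covers, lower element   *)
(* first.                                                                      *)
Definition mon_le I : 'X_{1..n} -> 'X_{1..n} -> Prop :=
  clos_refl_trans _ (fun v u => covers I u v).

Definition maximal I u : Prop :=
  min_gens I u /\ (forall v, min_gens I v -> mon_le I u v -> v = u).

Definition minimal I u : Prop :=
  min_gens I u /\ (forall v, min_gens I v -> mon_le I v u -> v = u).

Lemma mon_ideal_mem M m : M m -> mon_ideal M 'X_[m].
Proof.
move=> Mm; exists [:: (1, 'X_[m])]; last by rewrite big_seq1 mul1r.
by move=> p /[!inE] /eqP -> /=; exists m.
Qed.

Lemma mon_idealP M m :
  mon_ideal M 'X_[m] <-> exists2 u, M u & (u <= m)%MM.
Proof.
split=> [[s sM Xm]|[u Mu le_um]]; last first.
  exists [:: ('X_[m - u], 'X_[u])]; last first.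
    by rewrite big_seq1 -mpolyXD submK.
  by move=> p /[!inE] /eqP -> /=; exists u.
have : ('X_[m] : {mpoly K[n]})@_m != 0 by rewrite mcoeffX eqxx oner_eq0.
rewrite Xm; elim: s sM {Xm} => [|p s IHs] sM.
  by rewrite big_nil mcoeff0 eqxx.
rewrite big_cons mcoeffD.
have [-> | nz _] := eqVneq (p.1 * p.2)@_m 0.
  by rewrite add0r; apply: IHs => q sq; apply: sM; rewrite inE sq orbT.
have [u Mu p2E] := sM p (mem_head _ _); exists u => //.
move: nz; rewrite p2E -mcoeff_msupp => /msuppM_le/allpairsP[[v w]] /= [_].
by rewrite msuppX inE => /eqP -> ->; apply: lem_addl.
Qed.

Lemma min_gens_le I m :
  I 'X_[m] -> exists2 u, min_gens I u & (u <= m)%MM.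
Proof.
have [N] := ubnP (mdeg m); elim: N m => // N IHN m /ltnSE le_mN Im.
have [Gm|nGm] := classic (min_gens I m); first by exists m => //; apply/mnm_lepP.
have [v [Iv le_vm ne_vm]] : exists v, [/\ I 'X_[v], (v <= m)%MM & v != m].
  apply: NNPP => noV; apply: nGm; split=> // v Iv le_vm.
  by apply/eqP/idPn => ne_vm; apply: noV; exists v.
have lt_vm : (mdeg v < mdeg m)%N.
  rewrite -(submK le_vm) mdegD -[X in (X < _)%N]add0n ltn_add2r lt0n mdeg_eq0.
  by apply: contraNneq ne_vm => d0; rewrite -(submK le_vm) d0 add0m.
have [u Gu le_uv] := IHN v (leq_trans lt_vm le_mN) Iv.
exists u => //; apply/mnm_lepP => i.
by apply: leq_trans (mnm_lepP le_uv i) (mnm_lepP le_vm i).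
Qed.

Lemma ideal_gen_mono (R : comNzRingType) (X Y : R -> Prop) :
  (forall f, X f -> ideal_gen Y f) -> forall f, ideal_gen X f -> ideal_gen Y f.
Proof.
move=> XY f [s sX ->]; elim: s sX => [|p s IHs] sX.
  by exists [::]; rewrite ?big_nil.
have [q qs|t tY Et] := IHs; first by apply: sX; rewrite inE qs orbT.
have [t' t'Y Et'] := XY _ (sX p (mem_head _ _)).
exists ([seq (p.1 * q.1, q.2) | q <- t'] ++ t) => [q|].
  rewrite mem_cat => /orP[/mapP[q' tq' ->] /=|/tY //]; exact: t'Y.
rewrite big_cons Et Et' big_cat big_map mulr_sumr; congr (_ + _).
by apply: eq_bigr => q _; rewrite mulrA.
Qed.

Lemma min_gens_gen M f :
  mon_ideal (min_gens (mon_ideal M)) f <-> mon_ideal M f.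
Proof.
split; apply: ideal_gen_mono => _ [m Mm ->]; first by case: Mm.
have [u Gu le_um] := min_gens_le (mon_ideal_mem Mm).
by apply/mon_idealP; exists u.
Qed.

Lemma min_gens_least M u : min_gens (mon_ideal M) u -> M u.
Proof.
case=> /mon_idealP[v Mv le_vu] min_u.
by rewrite -(min_u v (mon_ideal_mem Mv) le_vu).
Qed.

Lemma mon_le_order I : Relation_Definitions.order _ (mon_le I).
Proof.
pose wt u := (\sum_(i < n) i * u i)%N.
have wtD u v : wt (u + v)%MM = (wt u + wt v)%N.
  by rewrite -big_split; apply: eq_bigr => i _; rewrite mnmDE mulnDr.
have wtU (i : 'I_n) : wt U_(i)%MM = i.
  rewrite /wt (bigD1 i) //= mnm1E eqxx muln1 big1 ?addn0 // => j ne_ji.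
  by rewrite mnm1E eq_sym (negbTE ne_ji) muln0.
have le_wt u v : mon_le I u v -> u = v \/ (wt u < wt v)%N.
  elim=> {u v} [u v [_ _ [i [j [lt_ij le_jv ->]]]]|u|u v w _ [->|uv] _ [<-|vw]].
  - by right; rewrite -[in X in (_ < X)%N](submK le_jv) !wtD !wtU ltn_add2l.
  - by left.
  - by left.
  - by right.
  - by right.
  - by right; apply: ltn_trans uv vw.
split=> [u|u v w uv vw|u v /le_wt[//|uv] /le_wt[//|vu]].
- exact: rt_refl.
- exact: rt_trans uv vw.
by have := ltn_trans uv vu; rewrite ltnn.
Qed.

End MonomialIdeals.

Definition veronese_ideal (K : fieldType) (c n d t : nat) :
    {mpoly K[n]} -> Prop :=
  mon_ideal (fun m => exists2 A, bounded_spread c d t A & m = xmon A).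

(* Main.v *)
Require Import Defs.
From Stdlib Require Import Relations.
From mathcomp Require Import all_boot all_order all_algebra.
From mathcomp Require Import mpoly.
From mathcomp Require Import zify.

(** Adding up the constraints on a t-spread multiset [A_0 <= ... <= A_(d-1)]
    without blocks of size c + 1 shows that two entries [m] places apart differ
    by at least [gap m = m * t + m %/ c]: each step costs [t], and each run of
    [c] steps costs one more, as otherwise these [c] steps would be an overlong
    block.  Conversely these lower bounds on differences give back the original
    conditions ([bounded_spreadP]).

    A system of inequalities [A_i + gap (j - i) <= A_j] for [i <= j] has two
    useful features.  Since [gap] is superadditive ([gapD]), packing the entries
    as tightly as possible against 1, that is [alpha_i = gap i] counted from 0,
    or against n, that is [a_i = n - 1 - gap (d - 1 - i)], gives solutions; they
    are the pointwise least and the pointwise greatest one.  Moreover, if [A] is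
    pointwise below [B] and both are solutions, then so is the sequence made of
    the first [k] entries of [A] followed by the remaining entries of [B]
    ([spaced_hybrid]).  Letting [k] grow from 0 to d changes [B] into [A] one
    entry at a time, so that the pointwise order implies the order generated by
    the covers ([mon_le_pointwise]).

    All generators of the ideal have degree d, so none divides another one and
    the minimal generators are exactly the monomials of the solutions
    ([min_gens_veronese]).  Hence alpha and a give the least and the greatest
    element of the poset, which by antisymmetry are its only minimal and its
    only maximal element.  The ceilings in the statement come from writing
    [gap] in terms of the distance to the last entry ([ceil_divr]). *)

Set Implicit Arguments.
Unset Strict Implicit.
Unset Printing Implicit Defensive.

Import GRing.Theory Num.Theory.
Local Open Scope ring_scope.

(** * Bounded spread sequences as solutions of difference inequalities *)

Section Spacing.
Local Open Scope nat_scope.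
Context {n : nat} (c t : nat) (c_gt0 : 0 < c).
Implicit Types A B : seq 'I_n.

(** The least possible difference of two entries that are [m] places apart. *)
Definition gap m := m * t + m %/ c.

(** Superadditivity is what makes the tightest packings satisfy every
    constraint, and not only those that involve an end of the sequence. *)
Lemma gapD l m : gap l + gap m <= gap (l + m).
Proof. by rewrite /gap divnD // mulnDl; lia. Qed.

(** Entries are read with indices and values both starting from 0, so that the
    default value 0 occurs only past the end. *)
Definition value A i := nth 0 [seq val j | j <- A] i.

Lemma value_cat A B i :
  value (A ++ B) i =
    if i < size A then value A i else value B (i - size A).
Proof. by rewrite /value map_cat nth_cat size_map. Qed.

Lemma value_ltn A i : i < size A -> value A i < n.
Proof.
move=> ltiA; have : value A i \in [seq val j | j <- A].
  by rewrite mem_nth ?size_map.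
by case/mapP=> j _ ->; apply: ltn_ord.
Qed.

Definition spaced A :=
  forall i j, i <= j < size A -> value A i + gap (j - i) <= value A j.

Lemma sorted_value (e : rel nat) A :
  sorted (relpre val e) A <->
    forall i, i.+1 < size A -> e (value A i) (value A i.+1).
Proof.
rewrite -sorted_map; split=> [/(sortedP 0)|] H.
  by move=> i ltiA; apply: H; rewrite size_map.
by apply/(sortedP 0) => i; rewrite size_map; apply: H.
Qed.

Lemma t_spread_steps A : t_spread t A ->
  forall i m, i + m < size A -> value A i + m * t <= value A (i + m).
Proof.
move=> /(sorted_value (fun i j => i + t <= j)) step i.
elim=> [|m IHm] ltim; first by rewrite !addn0.
have := IHm ltac:(lia); have := step (i + m) ltac:(lia).
by rewrite addnS mulSn; lia.
Qed.

(** If [c] consecutive steps added up to no more than [c * t], each of them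
    would equal [t], and the entries involved would be a block of size c + 1. *)
Lemma t_spread_long_gap A :
    t_spread t A -> (forall B, block t B A -> size B <= c) ->
  forall i, i + c < size A -> value A i + c * t < value A (i + c).
Proof.
move=> /t_spread_steps run short i ltA.
rewrite ltnNge; apply/negP => tight.
have szB : size (take c.+1 (drop i A)) = c.+1.
  by rewrite size_takel // size_drop; lia.
suff /short : block t (take c.+1 (drop i A)) A by rewrite szB ltnn.
apply/andP; split; first exact: infix_trans (infix_take _ _) (infix_drop _ _).
apply/(sorted_value (fun i j => i + t == j)) => j; rewrite szB => ltjc.
rewrite /value map_take map_drop !nth_take ?nth_drop; try lia.
rewrite -!/(value A _) addnS.
(* The step from i + j to i + j + 1 is squeezed between the j steps before it
   and the c - j - 1 steps after it. *)
have Dc : c = j + 1 + (c - j.+1) by lia.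
have := run i j ltac:(lia); have := run (i + j) 1 ltac:(lia).
have := run (i + j).+1 (c - j.+1) ltac:(lia).
have -> : (i + j).+1 + (c - j.+1) = i + c by lia.
by move: tight; rewrite {2}Dc !mulnDl mul1n addn1; lia.
Qed.

Lemma bounded_spreadP d A :
  bounded_spread c d t A <-> size A = d /\ spaced A.
Proof.
split=> [[szA spA shortA]|[szA spA]].
  split=> // i j /andP[leij ltjA].
  (* From i to j there are (j - i) %/ c runs of c steps, then (j - i) %% c
     single steps. *)
  have long := t_spread_long_gap spA shortA.
  have laps q : i + q * c < size A ->
      value A i + q * (c * t).+1 <= value A (i + q * c).
    elim: q => [|q IHq] lt_q; first by rewrite mul0n !addn0.
    have := IHq ltac:(lia); have := long (i + q * c) ltac:(lia).
    by rewrite -addnA [q * c + c]addnC -mulSn [q.+1 * _.+1]mulSn; lia.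
  have Dji := divn_eq (j - i) c.
  have := laps ((j - i) %/ c) ltac:(lia).
  have := @t_spread_steps A spA (i + (j - i) %/ c * c) ((j - i) %% c) ltac:(lia).
  rewrite -addnA -Dji subnKC // /gap.
  have -> : (j - i) * t = (j - i) %/ c * (c * t) + (j - i) %% c * t.
    by rewrite mulnA -mulnDl -Dji.
  by rewrite mulnS; lia.
split=> //.
  apply/(sorted_value (fun i j => i + t <= j)) => i ltiA.
  have := spA i i.+1 ltac:(lia); rewrite /gap subSnn mul1n addnA.
  exact: leq_trans (leq_addr _ _).
move=> B /andP[/infixP[s1 [s2 DA]]].
move/(sorted_value (fun i j => i + t == j)) => tight.
rewrite leqNgt; apply/negP => ltcB.
(* The first and the (c + 1)-st entry of B differ by c * t < gap c. *)
have valB j : j < size B -> value A (size s1 + j) = value B j.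
  by move=> ltjB; rewrite DA !value_cat addKn ltjB ltnNge leq_addr.
have run j : j < size B -> value B j = value B 0 + j * t.
  elim: j => [|j IHj] ltjB; first by rewrite addn0.
  by rewrite -(eqP (tight j ltjB)) IHj ?mulSn; lia.
have /(spA (size s1)) : size s1 <= size s1 + c < size A.
  rewrite leq_addr DA !size_cat ltn_add2l; exact: leq_trans ltcB (leq_addr _ _).
rewrite valB // -[in value A _](addn0 (size s1)) valB; last first.
  exact: leq_ltn_trans ltcB.
by rewrite addKn (run c) // /gap divnn c_gt0 leq_add2l addn1 ltnn.
Qed.

(** A constraint between a place before the cut and one after it holds because
    lowering its left-hand entry from [B] to [A] only weakens it. *)
Lemma spaced_hybrid A B k :
    size A = size B -> (forall i, i < size B -> value A i <= value B i) ->
  spaced A -> spaced B -> spaced (take k A ++ drop k B).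
Proof.
move=> szAB leAB spA spB.
have szH : size (take k A ++ drop k B) = size B.
  by rewrite size_cat size_take size_drop szAB; case: ltnP; lia.
have valH i : i < size B ->
    value (take k A ++ drop k B) i = if i < k then value A i else value B i.
  move=> ltiB; rewrite value_cat size_take szAB; case: (ltnP k (size B)) => kB.
    case: ltnP => ik; first by rewrite /value map_take nth_take.
    by rewrite /value map_drop nth_drop subnKC.
  by rewrite ltiB (leq_trans ltiB kB) take_oversize // szAB.
move=> i j; rewrite szH => ijB.
rewrite !valH; [|lia|lia].
have spBij := spB i j ijB; have spAij : value A i + gap (j - i) <= value A j.
  by apply: spA; rewrite szAB.
have := leAB i ltac:(lia); case: (ltnP i k); case: (ltnP j k) => /= ? ?; lia.
Qed.

End Spacing.

(** * The order on the minimal generators *)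

Section Order.
Context {K : fieldType} {n : nat}.
Implicit Types (A B : seq 'I_n) (I : {mpoly K[n]} -> Prop).

Lemma xmon_cat A B : xmon (A ++ B) = (xmon A + xmon B)%MM.
Proof. by rewrite /xmon big_cat. Qed.

Lemma xmon_cons i A : xmon (i :: A) = (U_(i) + xmon A)%MM.
Proof. by rewrite /xmon big_cons. Qed.

Lemma mdeg_xmon A : mdeg (xmon A) = size A.
Proof.
elim: A => [|i A IHA]; first by rewrite /xmon big_nil mdeg0.
by rewrite xmon_cons mdegD mdeg1 IHA.
Qed.

Lemma lem_mdeg_eq (u v : 'X_{1..n}) :
  (u <= v)%MM -> (mdeg v <= mdeg u)%N -> u = v.
Proof.
move=> leuv; rewrite -{1}(submK leuv) mdegD -{2}[mdeg u]add0n leq_add2r leqn0.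
by rewrite mdeg_eq0 => /eqP vu0; rewrite -(submK leuv) vu0 add0m.
Qed.

(** All generators have the same degree, so no one properly divides another. *)
Lemma min_gens_veronese c d t u :
  min_gens (@veronese_ideal K c n d t) u <->
    exists2 A, bounded_spread c d t A & u = xmon A.
Proof.
split=> [/min_gens_least//|[A bsA ->]]; split.
  by apply: mon_ideal_mem; exists A.
move=> v /mon_idealP[_ [B [szB _ _] ->] leBv] levA; have [szA _ _] := bsA.
apply: lem_mdeg_eq levA _; rewrite mdeg_xmon szA -szB -mdeg_xmon.
by rewrite -(submK leBv) mdegD leq_addl.
Qed.

Lemma covers_entry I A B (i j : 'I_n) :
    (i < j)%N -> min_gens I (xmon (A ++ i :: B)) ->
    min_gens I (xmon (A ++ j :: B)) ->
  covers I (xmon (A ++ j :: B)) (xmon (A ++ i :: B)).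
Proof.
move=> ltij Gi Gj; split=> //; exists i, j.
have xmonE (l : 'I_n) : xmon (A ++ l :: B) = (xmon (A ++ B) + U_(l))%MM.
  by rewrite !xmon_cat xmon_cons [(U_(l) + _)%MM]addmC addmA.
by rewrite !xmonE; split; rewrite ?lem_addl ?addmK.
Qed.

(** Consecutive hybrids of [A] and [B] differ in at most one entry, so they give
    equal monomials or a cover, and the hybrids form a chain from [xmon B] down
    to [xmon A]. *)
Lemma mon_le_pointwise c d t A B : (0 < c)%N ->
    bounded_spread c d t A -> bounded_spread c d t B ->
    (forall i, (i < d)%N -> (value A i <= value B i)%N) ->
  mon_le (@veronese_ideal K c n d t) (xmon A) (xmon B).
Proof.
move=> c_gt0 /(bounded_spreadP _ c_gt0 _ _)[szA spA].
move=> /(bounded_spreadP _ c_gt0 _ _)[szB spB] leAB.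
pose hybrid k := take k A ++ drop k B.
have genH k : min_gens (@veronese_ideal K c n d t) (xmon (hybrid k)).
  apply/min_gens_veronese; exists (hybrid k) => //.
  apply/bounded_spreadP => //; split.
    by rewrite size_cat size_take size_drop szA szB; case: ltnP; lia.
  by apply: spaced_hybrid; rewrite ?szA ?szB.
suff H k : (k <= d)%N ->
    mon_le (@veronese_ideal K c n d t) (xmon (hybrid k)) (xmon B).
  by have := H d (leqnn d); rewrite /hybrid take_oversize ?szA //
    drop_oversize ?szB // cats0.
elim: k => [_|k IHk ltkd].
  by rewrite /hybrid take0 drop0; apply: rt_refl.
apply: rt_trans (IHk (ltnW ltkd)).
have x0 : 'I_n by case: (A) szA ltkd => [<-|].
have Dk : hybrid k = take k A ++ nth x0 B k :: drop k.+1 B.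
  by rewrite /hybrid (drop_nth x0) ?szB.
have Dk1 : hybrid k.+1 = take k A ++ nth x0 A k :: drop k.+1 B.
  by rewrite /hybrid (take_nth x0) ?szA // cat_rcons.
have := leAB k ltkd; rewrite /value !(nth_map x0) ?szA ?szB //.
rewrite leq_eqVlt => /orP[/eqP/val_inj eqk|ltk].
  by rewrite Dk Dk1 eqk; apply: rt_refl.
have Gk := genH k; have Gk1 := genH k.+1; rewrite Dk Dk1 in Gk Gk1 *.
exact/rt_step/covers_entry.
Qed.

Lemma least_unique_minimal I u :
    min_gens I u -> (forall v, min_gens I v -> mon_le I u v) ->
  unique (minimal I) u.
Proof.
have [_ _ antisym] := mon_le_order I => Gu least; split=> [|v [Gv min_v]].
  by split=> // v Gv levu; apply: antisym levu (least v Gv).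
exact: min_v (least v Gv).
Qed.

Lemma greatest_unique_maximal I u :
    min_gens I u -> (forall v, min_gens I v -> mon_le I v u) ->
  unique (maximal I) u.
Proof.
have [_ _ antisym] := mon_le_order I => Gu greatest; split=> [|v [Gv max_v]].
  by split=> // v Gv leuv; apply: antisym (greatest v Gv) leuv.
exact: max_v (greatest v Gv).
Qed.

End Order.

(** * The extremal sequences *)

Lemma veronese_neq0 (K : fieldType) n c d t (f : {mpoly K[n]}) :
  veronese_ideal c d t f -> f <> 0 ->
  exists A : seq 'I_n, bounded_spread c d t A.
Proof.
case=> [[|p s] gens ->]; first by rewrite big_nil.
by have [m [A bsA _] _] := gens p (mem_head _ _); exists A.
Qed.

Lemma exists_tuple_value n d (f : nat -> nat) :
    (forall i, (i < d)%N -> (f i < n)%N) ->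
  exists a : d.-tuple 'I_n, forall i, (i < d)%N -> value a i = f i.
Proof.
move=> f_lt; exists [tuple Ordinal (f_lt i (ltn_ord i)) | i < d] => i ltid.
have x0 : 'I_n := Ordinal (f_lt i ltid).
rewrite /value (nth_map x0) ?size_tuple //.
by rewrite (nth_mktuple _ _ (Ordinal ltid)).
Qed.

Lemma entry_value n (A : seq 'I_n) i :
  (1 <= i <= size A)%N -> entry A i = (value A (i - 1)).+1.
Proof.
case: i => // i /= ltiA; rewrite subn1 /= /entry /value.
by case: A ltiA => [|x A] // ltiA; rewrite !(nth_map x).
Qed.

Lemma ceil_divr (m : int) (c : nat) (q : int) : (0 < c)%N ->
  (q - 1) * c%:Z < m <= q * c%:Z -> Num.ceil (m%:~R / c%:R : rat) = q.
Proof.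
move=> c_gt0 /andP[ltm lem]; apply: ceil_def.
have c0 : 0 < c%:R :> rat by rewrite ltr0n.
rewrite ltr_pdivlMr // ler_pdivrMr //.
rewrite -[c%:R]/(c%:Z%:~R) -!intrM ltr_int ler_int.
by rewrite ltm lem.
Qed.

Theorem theorem4p4 (K : fieldType) (n d c t k r : nat)
  (hn : (1 <= n)%N) (hd : (1 <= d)%N) (hc : (1 <= c)%N)
  (hI : exists2 f : {mpoly K[n]}, veronese_ideal c d t f & f <> 0)
  (hkr : d = (k * c + r)%N) (hr : (0 < r <= c)%N) :
  [/\ k = ((d - 1) %/ c)%N,
      exists a : d.-tuple 'I_n,
        [/\ forall i : nat, (1 <= i <= d)%N ->
              (entry a i)%:Z =
                n%:Z - k%:Z - t%:Z * (d%:Z - 1) + (i%:Z - 1) * t%:Z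
                + Num.ceil ((i%:Z - r%:Z)%:~R / c%:R : rat),
            forall i : nat, (1 <= i <= d)%N ->
              (entry a i)%:Z =
                (entry a 1)%:Z + (i%:Z - 1) * t%:Z
                + Num.ceil ((i%:Z - r%:Z)%:~R / c%:R : rat),
            forall i : nat, (1 <= i <= d)%N ->
              (entry a (d - i + 1))%:Z =
                n%:Z - (i%:Z - 1) * t%:Z - ((i - 1) %/ c)%N%:Z &
            unique (maximal (@veronese_ideal K c n d t)) (xmon a)]
    & exists alpha : d.-tuple 'I_n,
        (forall i : nat, (1 <= i <= d)%N ->
           entry alpha i = ((i - 1) * t + (i - 1) %/ c + 1)%N) /\
        unique (minimal (@veronese_ideal K c n d t)) (xmon alpha)].
Proof.
have [f If f0] := hI; have [A0 bsA0] := veronese_neq0 If f0.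
have /(bounded_spreadP _ hc _ _)[szA0 spA0] := bsA0.
(* Any solution shows that n leaves room for the tightest packing. *)
have room : (gap c t (d - 1) < n)%N.
  have := spA0 0%N (d - 1)%N ltac:(lia); rewrite subn0.
  by have := @value_ltn _ A0 (d - 1) ltac:(lia); lia.
have gap_mono i j : (i <= j)%N -> (gap c t i <= gap c t j)%N.
  by move=> leij; have := gapD t hc i (j - i); rewrite subnKC //; lia.
have small i : (i < d)%N -> (gap c t i < n)%N.
  by move=> ltid; have := gap_mono i (d - 1)%N ltac:(lia); lia.
have small_rev i : (i < d)%N -> (n - 1 - gap c t (d - 1 - i) < n)%N by lia.
have [alpha val_alpha] := exists_tuple_value small.
have [a val_a] := exists_tuple_value small_rev.
have bs_alpha : bounded_spread c d t alpha.
  apply/bounded_spreadP => //; split=> [|i j]; rewrite size_tuple // => ijd.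
  rewrite !val_alpha; try lia.
  by have := gapD t hc i (j - i); rewrite subnKC //; lia.
have bs_a : bounded_spread c d t a.
  apply/bounded_spreadP => //; split=> [|i j]; rewrite size_tuple // => ijd.
  rewrite !val_a; try lia.
  have := gapD t hc (d - 1 - j) (j - i).
  have -> : (d - 1 - j + (j - i) = d - 1 - i)%N by lia.
  by have := small (d - 1 - i)%N ltac:(lia); lia.
have kE : k = ((d - 1) %/ c)%N.
  have -> : (d - 1 = k * c + (r - 1))%N by lia.
  by rewrite divnMDl // divn_small; lia.
have entry_rev i : (1 <= i <= d)%N ->
    (entry a i)%:Z = n%:Z - (d - i)%:Z * t%:Z - ((d - i) %/ c)%N%:Z.
  move=> id; rewrite entry_value ?size_tuple // val_a; last lia.
  have -> : (d - 1 - (i - 1) = d - i)%N by lia.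
  by have := small (d - i)%N ltac:(lia); rewrite /gap; lia.
have ceilE i : (1 <= i <= d)%N ->
    Num.ceil ((i%:Z - r%:Z)%:~R / c%:R : rat) = k%:Z - ((d - i) %/ c)%N%:Z.
  move=> id; apply: ceil_divr => //.
  have := divn_eq (d - i) c; have := ltn_pmod (d - i) hc.
  move: ((d - i) %/ c)%N ((d - i) %% c)%N => q s lts Dq; nia.
have formula i : (1 <= i <= d)%N ->
    (entry a i)%:Z = n%:Z - k%:Z - t%:Z * (d%:Z - 1) + (i%:Z - 1) * t%:Z
                + Num.ceil ((i%:Z - r%:Z)%:~R / c%:R : rat).
  by move=> id; rewrite entry_rev // ceilE // -subzn; [nia|lia].
split=> //.
  exists a; split=> //.
  - move=> i id; rewrite (formula i id) (formula 1%N) //.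
    have -> : Num.ceil ((1%:Z - r%:Z)%:~R / c%:R : rat) = 0.
      by apply: ceil_divr => //; lia.
    by rewrite subrr mul0r !addr0; lia.
  - move=> i id; rewrite entry_rev; last lia.
    have -> : (d - (d - i + 1) = i - 1)%N by lia.
    by rewrite -subzn; lia.
  apply: greatest_unique_maximal => [|_ /min_gens_veronese[A bsA ->]].
    by apply/min_gens_veronese; exists a.
  apply: mon_le_pointwise => // i ltid.
  have /(bounded_spreadP _ hc _ _)[szA spA] := bsA.
  have := spA i (d - 1)%N ltac:(lia).
  by have := @value_ltn _ A (d - 1) ltac:(lia); rewrite val_a; lia.
exists alpha; split=> [i id|].
  by rewrite entry_value ?size_tuple // val_alpha /gap; lia.
apply: least_unique_minimal => [|_ /min_gens_veronese[A bsA ->]].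
  by apply/min_gens_veronese; exists alpha.
apply: mon_le_pointwise => // i ltid.
have /(bounded_spreadP _ hc _ _)[szA spA] := bsA.
by have := spA 0%N i ltac:(lia); rewrite subn0 val_alpha; lia.
Qed.
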